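(* Let $\mathcal{H}$ be a separable complex Hilbert space, let $x_1,\dots,x_n\in\mathcal{H}$, and let $t_1,\dots,t_n$ be nonnegative numbers with $\sum_{i=1}^n t_i=1$. Then $$\sum_{i=1}^n t_i\Big\|x_i-\sum_{j=1}^n t_jx_j\Big\|^2=\sum_{i=1}^n t_i\|x_i\|^2-\Big\|\sum_{j=1}^n t_jx_j\Big\|^2 .$$
   Context: $\|\cdot\|$ denotes the norm induced by the inner product of $\mathcal{H}$. *)

(* Defs.v *)
From mathcomp Require Import all_boot all_order all_algebra.
From mathcomp Require Import all_classical all_reals all_analysis.

Set Implicit Arguments.
Unset Strict Implicit.
Unset Printing Implicit Defensive.

Definition separable (T : topologicalType) : Prop :=
  exists2 A : set T, countable A & dense A.

(* Main.v *)
Require Import Defs.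
From HB Require Import structures.
From mathcomp Require Import all_boot all_order all_algebra.
From mathcomp Require Import all_classical all_reals all_analysis.
From mathcomp Require Import complex.

Set Implicit Arguments.
Unset Strict Implicit.
Unset Printing Implicit Defensive.

Import Order.TTheory GRing.Theory Num.Theory Num.Def.
Import numFieldNormedType.Exports.

Local Open Scope ring_scope.
Local Open Scope complex_scope.

(** Expand each square about the weighted mean [m]. Summed with the weights, each of the two cross
    terms becomes [- dot m m], by additivity in one slot, while the constant term gives [+ dot m m],
    the weights having sum 1; one [- dot m m] survives. *)

Theorem corollary2p7 (R : realType)
    (* H is a separable complex Hilbert space: a complete normed space over
       R[i] whose norm is induced by the inner product dot *)
    (H : completeNormedModType R[i]) (dot : {dot H for conjC})
    (norm_dot : forall u : H, `|u| = sqrtC (dot u u))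
    (H_separable : separable H)
    (n : nat) (x : 'I_n -> H) (t : 'I_n -> R)
    (t_ge0 : forall i, 0 <= t i) (t_sum1 : \sum_(i < n) t i = 1) :
  \sum_(i < n) (t i)%:C * `|x i - \sum_(j < n) (t j)%:C *: x j| ^+ 2
  = \sum_(i < n) (t i)%:C * `|x i| ^+ 2
    - `|\sum_(j < n) (t j)%:C *: x j| ^+ 2.
Proof.
set m := \sum_(j < n) _ *: _.
have sqr_norm (u : H) : `|u| ^+ 2 = dot u u by rewrite norm_dot sqrtCK.
(* The weight stays inside [dot] in the cross terms, so that their sums rebuild [m]. *)
have expand i : (t i)%:C * `|x i - m| ^+ 2 =
    (t i)%:C * `|x i| ^+ 2 - dot ((t i)%:C *: x i) m
    - dot m ((t i)%:C *: x i) + (t i)%:C * dot m m.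
  rewrite !sqr_norm linearBl !linearBr linearZl_LR linearZr_LR /=.
  (* The form is conjugate-linear in one slot; a real weight comes out of it unchanged. *)
  have -> : conjC (t i)%:C = (t i)%:C by exact: conjc_real.
  by rewrite opprB addrA addrAC.
rewrite (eq_bigr _ (fun i _ => expand i)) big_split /= !sumrB.
rewrite -linear_sumr -linear_sumlz -/m -mulr_suml -rmorph_sum /= t_sum1 mul1r.
by rewrite -addrA addNr addr0 sqr_norm.
Qed.
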